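(* Let $F\in\mathbb{N}\setminus\{0\}$. Then $\mathrm{Arf}(F)=\{S\mid S \text{ is an A-semigroup and } \mathrm{F}(S)=F\}$ is a covariety.
   Context: $\mathbb{N}$ denotes the set of nonnegative integers. A numerical semigroup is a subset $S\subseteq\mathbb{N}$ that contains $0$, is closed under addition, and has finite complement in $\mathbb{N}$. The multiplicity is $\mathrm{m}(S)=\min(S\setminus\{0\})$, and the Frobenius number $\mathrm{F}(S)$ is the greatest integer not in $S$. An A-semigroup (Arf numerical semigroup) is a numerical semigroup $S$ such that $x+y-z\in S$ for all $x,y,z\in S$ with $x\ge y\ge z$. A covariety is a nonempty family $\mathscr{C}$ of numerical semigroups such that: 1) $\mathscr{C}$ has a minimum $\Delta(\mathscr{C})$ with respect to set inclusion; 2) if $S,T\in\mathscr{C}$, then $S\cap T\in\mathscr{C}$; 3) if $S\in\mathscr{C}$ and $S\neq\Delta(\mathscr{C})$, then $S\setminus\{\mathrm{m}(S)\}\in\mathscr{C}$. *)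

(* Defs.v *)
From mathcomp Require Import all_boot all_order all_algebra.
From mathcomp Require Import boolp classical_sets cardinality.
Set Implicit Arguments.
Unset Strict Implicit.
Unset Printing Implicit Defensive.
Local Open Scope classical_set_scope.

Definition numerical_semigroup (S : set nat) : Prop :=
  [/\ S 0, forall x y, S x -> S y -> S (x + y) & finite_set (~` S)].

(* The default value 0 is never used for a numerical semigroup, which always
   contains a nonzero element. *)
Definition multiplicity (S : set nat) : nat :=
  xget 0 ((S `\ 0) `&` lbound (S `\ 0)).

(* The greatest integer (not natural number) outside S, so that the Frobenius
   number of the whole of nat is -1. The default value is never used for a
   numerical semigroup, whose complement in int is nonempty and bounded above. *)
Definition frobenius (S : set nat) : int :=
  let gaps := ~` (Posz @` S) in xget (-1)%R (gaps `&` ubound gaps).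

(* Since x >= y >= z, the truncated subtraction below is exact. *)
Definition A_semigroup (S : set nat) : Prop :=
  numerical_semigroup S /\
  forall x y z, S x -> S y -> S z -> y <= x -> z <= y -> S (x + y - z).

Definition is_minimum (C : set (set nat)) (D : set nat) : Prop :=
  C D /\ forall S, C S -> D `<=` S.

(* The minimum Delta is unique when it exists, by antisymmetry of inclusion. *)
Definition covariety (C : set (set nat)) : Prop :=
  [/\ C !=set0,
      C `<=` numerical_semigroup &
      exists Delta, [/\ is_minimum C Delta,
        forall S T, C S -> C T -> C (S `&` T) &
        forall S, C S -> S <> Delta -> C (S `\ multiplicity S)]].

Definition Arf (F : nat) : set (set nat) :=
  [set S | A_semigroup S /\ frobenius S = Posz F].

(* Main.v *)
Require Import Defs.
From mathcomp Require Import all_boot all_order all_algebra zify.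
From mathcomp Require Import boolp classical_sets cardinality.
Import Order.TTheory Num.Theory.
Local Open Scope classical_set_scope.

(** The condition F(S) = F only says that F is a gap of S and that every larger
    integer lies in S ([frobenius_eqP]). So Arf(F) consists of the sets that
    contain 0 and all n > F, avoid F, and are closed under x + y - z for
    x >= y >= z ([ArfP]). These conditions are clearly stable under
    intersection, and the least set containing 0 and all n > F satisfies them,
    hence is the minimum Delta.

    For the removal of the multiplicity m, the point is that m is the least
    nonzero element: if x >= y >= z are in S \ {m}, then x + y - z >= x, and
    either x > m, so that x + y - z > m, or x = y = z = 0. In both cases
    x + y - z differs from m. All n > F remain as long as m < F, and this holds
    because S, being different from Delta, has a nonzero element at most F. *)

(** A natural number F can never be the default value -1 in the definition of
    the Frobenius number, which makes the direct implication hold for all S. *)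
Lemma frobenius_eqP (S : set nat) (F : nat) :
  frobenius S = Posz F <-> ~ S F /\ forall n, F < n -> S n.
Proof.
rewrite /frobenius; set gaps := ~` _.
have gapE n : gaps (Posz n) <-> ~ S n.
  split=> [gapn Sn | nSn [k Sk [eq_kn]]]; first by apply: gapn; exists n.
  by apply: nSn; rewrite -eq_kn.
split=> [|[nSF SF]].
  case: xgetP => // _ -> [gapF maxF] eqF.
  rewrite eqF in gapF maxF; split; first exact/gapE.
  move=> n ltFn; apply: contrapT => /gapE /maxF.
  by rewrite leNgt ltz_nat ltFn.
have Fmax : (gaps `&` ubound gaps) (Posz F).
  split; first exact/gapE.
  move=> [n|n] //= /gapE nSn.
  by rewrite lez_nat leqNgt; apply/negP => /SF.
case: (Fmax) => gapF maxF.
apply: xget_unique => // y [gapy maxy].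
by apply/eqP; rewrite eq_le maxF // maxy.
Qed.

(** Closure under addition is the case z = 0 of the Arf property, and the
    complement is finite because it lies in {0, ..., F}. *)
Lemma ArfP (F : nat) (S : set nat) :
  Arf F S <->
  [/\ S 0, ~ S F, forall n, F < n -> S n &
      forall x y z, S x -> S y -> S z -> y <= x -> z <= y -> S (x + y - z)].
Proof.
split=> [[[[S0 _ _] arfS] /frobenius_eqP[nSF SF]] | [S0 nSF SF arfS]] //.
split; last exact/frobenius_eqP.
split=> //; split=> // [x y Sx Sy|].
  case: (leqP y x) => [le_yx|/ltnW le_xy].
    by rewrite -[x + y]subn0; apply: arfS.
  by rewrite addnC -[y + x]subn0; apply: arfS.
apply: (sub_finite_set _ (finite_II F.+1)) => n nSn /=.
by rewrite ltnS leqNgt; apply/negP => /SF.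
Qed.

Lemma multiplicityP (S : set nat) : S `\ 0 !=set0 ->
  (S `\ 0) (multiplicity S) /\ forall n, (S `\ 0) n -> multiplicity S <= n.
Proof.
move=> [s Ss]; have exS : exists n, `[< (S `\ 0) n >] by exists s; apply/asboolP.
have [m /asboolP Sm minm] := ex_minnP exS.
have : ((S `\ 0) `&` lbound (S `\ 0)) m.
  by split=> // n Sn; rewrite leEnat; apply/minm/asboolP.
by rewrite /multiplicity; case: xgetP => [_ -> [mulS lbS] _|nex /nex].
Qed.

Theorem proposition2p7 (F : nat) (hF : F <> 0) : covariety (Arf F).
Proof.
pose Delta : set nat := [set n | n = 0 \/ F < n].
have ArfDelta : Arf F Delta.
  apply/ArfP; split=> /=; [by left | by case=> //; rewrite ltnn | by right |].
  move=> x y z Dx _ _ le_yx le_zy; move: Dx; rewrite /Delta /=; lia.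
have minDelta S : Arf F S -> Delta `<=` S.
  by move=> /ArfP[S0 _ SF _] n [->|/SF].
split; first by exists Delta.
  by move=> S [[]].
exists Delta; split=> // [S T|S].
  move=> /ArfP[S0 nSF SF arfS] /ArfP[T0 _ TF arfT]; apply/ArfP; split=> //.
  - by case.
  - by move=> n ltFn; split; [exact: SF | exact: TF].
  - move=> x y z [Sx Tx] [Sy Ty] [Sz Tz] le_yx le_zy.
    by split; [exact: arfS | exact: arfT].
move=> ArfS neqS; have /ArfP[S0 nSF SF arfS] := ArfS.
have [s [Ss s_neq0] le_sF] : exists2 s, (S `\ 0) s & s <= F.
  apply: contrapT => noS; apply: neqS; apply/seteqP; split; last exact: minDelta.
  move=> n Sn; have [->|n_neq0] := eqVneq n 0; first by left.
  right; rewrite ltnNge; apply/negP => le_nF; apply: noS.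
  by exists n => //; split=> //; apply/eqP.
have [|[Sm m_neq0] minm] := @multiplicityP S; first by exists s; split.
move: (multiplicity S) Sm m_neq0 minm => m Sm /= m_neq0 minm.
have lt_mF : m < F.
  rewrite ltn_neqAle (leq_trans (minm s _) le_sF) ?andbT; last by split.
  by apply/eqP => eq_mF; apply: nSF; rewrite -eq_mF.
apply/ArfP; split.
- by split=> // /esym.
- by case.
- by move=> n ltFn; split; [exact: SF | move=> /=; lia].
- move=> x y z [Sx x_neqm] [Sy _] [Sz _] le_yx le_zy; split; first exact: arfS.
  have [x0|x_neq0] := eqVneq x 0; first by move=> /=; lia.
  have le_mx : m <= x by apply: minm; split=> //; apply/eqP.
  by move: x_neqm => /=; lia.
Qed.
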